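(* For every integer $n\ge1$, the number $K'(n)$ of non-equivalent colorful $n$-bead bracelets with three colors is given by $$K'(n)=\frac{K(n)+R(n)}{2},$$ where $$R(n)=\begin{cases}2^{n/2-1}&\text{if } n \text{ is even},\\[2pt] \frac13\left(2^{(n-1)/2}-(-1)^{(n-1)/2}\right)&\text{if } n\text{ is odd},\end{cases}$$ and $K(n)$ is the number of non-equivalent colorful $n$-bead necklaces with three colors, which is given by $$K(n)=\frac{1}{6n}\sum_{d\mid n}\bigl(1+\mathbb{I}_{2\mathbb{Z}\setminus 3\mathbb{Z}}(d)\bigr)\gcd(d,6)\,\varphi(d)\,2^{n/d}-\frac{1}{3^{1+\nu_3(n)}}\,\mathbb{I}_{\mathbb{Z}\setminus 2\mathbb{Z}}(n)=\left\lfloor \frac{1}{6n}\sum_{d\mid n}\bigl(1+\mathbb{I}_{2\mathbb{Z}\setminus 3\mathbb{Z}}(d)\bigr)\gcd(d,6)\,\varphi(d)\,2^{n/d}\right\rfloor .$$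
   Context: Let $\mathbb{N}_3=\{1,2,3\}$ (the three colors). For an integer $n\ge1$, $\mathcal{A}_n$ is the set of colorful $n$-periodic sequences, i.e. functions $f:\mathbb{Z}/n\mathbb{Z}\to\mathbb{N}_3$ with $f(i)\ne f(i+1)$ for all $i\in\mathbb{Z}/n\mathbb{Z}$; it represents the colorful $n$-bead necklaces or bracelets in at most three colors (for $n=1$ this set is empty). Let $s$ and $r$ be the permutations $s(i)=i+1$ and $r(i)=-i$ of $\mathbb{Z}/n\mathbb{Z}$, let $\langle s\rangle$ be the group generated by $s$, $\langle s,r\rangle$ the group generated by $s$ and $r$, and $\mathfrak{S}_3$ the symmetric group of $\mathbb{N}_3$. The groups $G=\mathfrak{S}_3\times\langle s\rangle$ and $G'=\mathfrak{S}_3\times\langle s,r\rangle$ act on $\mathcal{A}_n$ by $(\sigma,t)f=\sigma\circ f\circ t^{-1}$. Two colorful necklaces are equivalent if they lie in the same $G$-orbit, and two colorful bracelets are equivalent if they lie in the same $G'$-orbit. Thus $K(n)=|\mathcal{A}_n/G|$ and $K'(n)=|\mathcal{A}_n/G'|$ are the numbers of orbits. Notation: $\varphi$ is Euler's totient function; the sums run over the positive divisors $d$ of $n$; $\mathbb{I}_X$ is the indicator function of the set $X$; $2\mathbb{Z}\setminus3\mathbb{Z}$ is the set of integers divisible by $2$ but not by $3$, and $\mathbb{Z}\setminus2\mathbb{Z}$ is the set of odd integers; $3^{\nu_3(n)}$ is the largest power of $3$ dividing $n$. *)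

(* Defs.v *)
From HB Require Import structures.
From mathcomp Require Import all_boot all_order all_algebra all_fingroup.

Set Implicit Arguments.
Unset Strict Implicit.
Unset Printing Implicit Defensive.

Import GRing.Theory.

(* Z/nZ is represented by 'I_n (a one-element type for n = 1, unlike 'Z_1),
   with ordS : i |-> i.+1 %% n as its successor, and {1, 2, 3} by 'I_3. *)
Notation color := 'I_3.

Definition colorful (n : nat) : {set {ffun 'I_n -> color}} :=
  [set f : {ffun 'I_n -> color} | [forall i, f i != f (ordS i)]].

Definition rotation (n : nat) : {perm 'I_n} := perm (@ordS_inj n).

Fact ord_opp_subproof (n : nat) (i : 'I_n) : (n - i) %% n < n.
Proof. by rewrite ltn_mod; case: n i => [[]|]. Qed.

Definition ord_opp (n : nat) (i : 'I_n) : 'I_n := Ordinal (ord_opp_subproof i).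

Lemma ord_oppK (n : nat) : involutive (@ord_opp n).
Proof.
move=> i; apply: val_inj => /=.
case: i => [[|i] lt_in] /=; first by rewrite subn0 modnn subn0 modnn.
rewrite [X in n - X]modn_small; last by rewrite ltn_subrL /=; case: n lt_in.
by rewrite subKn ?modn_small // ltnW.
Qed.

Lemma ordS_opp (n : nat) (i : 'I_n) : ordS (ord_opp (ordS i)) = ord_opp i.
Proof.
apply: val_inj; case: i => i lt_in /=.
rewrite -addn1 modnDml addn1.
have [Dn|ne_in] := eqVneq i.+1 n.
  by rewrite -Dn modnn subn0 -[i.+2]addn1 modnDl subSn // subnn.
have lt_Sin : i.+1 < n by rewrite ltn_neqAle ne_in.
by rewrite (modn_small lt_Sin) subnSK.
Qed.

Definition reflection (n : nat) : {perm 'I_n} := perm (inv_inj (@ord_oppK n)).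

Section Action.

Variable n : nat.

Definition recolor (f : {ffun 'I_n -> color})
    (a : {perm color} * {perm 'I_n}) : {ffun 'I_n -> color} :=
  [ffun i => a.1 (f ((a.2^-1)%g i))].

Fact recolor1 f : recolor f 1%g = f.
Proof. by apply/ffunP => i; rewrite ffunE /= invg1 !perm1. Qed.

(* In MathComp (s * t) i = t (s i), so that the left action
   (sigma, t) f = sigma \o f \o t^-1 is a right action for this product. *)
Fact recolorM f a b : recolor f (a * b)%g = recolor (recolor f a) b.
Proof. by apply/ffunP => i; rewrite !ffunE /= invMg !permM. Qed.

Canonical recolor_action := TotalAction recolor1 recolorM.

Definition necklace_group : {group {perm color} * {perm 'I_n}} :=
  setX_group [group of [set: {perm color}]] [group of <[rotation n]>%g].

Definition bracelet_group : {group {perm color} * {perm 'I_n}} :=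
  setX_group [group of [set: {perm color}]]
             [group of <<[set rotation n; reflection n]>>%g].

End Action.

Lemma recolor_acts (n : nat) :
  [acts bracelet_group n, on colorful n | recolor_action n].
Proof.
have actP (a : {perm color} * {perm 'I_n}) :
    (forall f, f \in colorful n -> recolor f a \in colorful n) ->
    a \in ('N(colorful n | recolor_action n))%g.
  move=> Ha; rewrite inE in_setT inE /=.
  by apply/subsetP => f /Ha; rewrite [in X in _ -> X]inE.
have colorfulP (f : {ffun 'I_n -> color}) :
    reflect (forall i, f i != f (ordS i)) (f \in colorful n).
  by rewrite inE; apply: forallP.
have adjP (t : {perm 'I_n}) (g : 'I_n -> 'I_n) : cancel g t ->
    (forall i, ordS (g i) = g (ordS i) \/ ordS (g (ordS i)) = g i) ->
    (1%g, t) \in ('N(colorful n | recolor_action n))%g.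
  move=> gK Hg; apply: actP => f /colorfulP Hf; apply/colorfulP => i.
  have tV j : (t^-1)%g j = g j by rewrite -{1}[j]gK permK.
  rewrite !ffunE /= !tV !perm1.
  by case: (Hg i) => <-; first exact: Hf; rewrite eq_sym; apply: Hf.
have genN :
    (<<[set rotation n; reflection n]>>
      \subset @pair1g {perm color} {perm 'I_n}
                @*^-1 'N(colorful n | recolor_action n))%g.
  rewrite gen_subG; apply/subsetP => t /set2P[] ->; rewrite inE in_setT inE.
    apply: (adjP _ (@ord_pred n)) => i; first by rewrite permE ord_predK.
    by left; rewrite ord_predK ordSK.
  apply: (adjP _ (@ord_opp n)) => i; first by rewrite permE ord_oppK.
  by right; apply: ordS_opp.
apply/subsetP => -[s t] /setXP[_ /(subsetP genN)].
rewrite inE in_setT inE /= => tN.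
have -> : (s, t) = ((s, 1) * (1, t))%g.
  by congr (_, _) => /=; rewrite ?mulg1 ?mul1g.
rewrite groupMr //; apply: actP => f /colorfulP Hf; apply/colorfulP => i.
by rewrite !ffunE /= invg1 !perm1 (inj_eq perm_inj).
Qed.

Definition num_necklaces (n : nat) : nat :=
  #|orbit (recolor_action n) (necklace_group n) @: colorful n|.

Definition num_bracelets (n : nat) : nat :=
  #|orbit (recolor_action n) (bracelet_group n) @: colorful n|.

Local Open Scope ring_scope.

Definition necklace_sum (n : nat) : rat :=
  1 / (6 * n)%N%:R *
  \sum_(d <- divisors n)
    (1 + ((2 %| d) && ~~ (3 %| d))%N%:R) * (gcdn d 6)%:R *
    (totient d)%:R * 2 ^+ (n %/ d)%N.

Definition reflection_term (n : nat) : rat :=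
  if odd n then 1 / 3 * (2 ^+ n.-1./2 - (-1) ^+ n.-1./2) else 2 ^+ (n./2).-1.

(* Main.v *)
Require Import Defs.
From mathcomp Require Import all_boot all_order all_algebra.
From mathcomp Require Import all_fingroup cyclic.
From mathcomp Require Import zify ring lra.

(** Burnside's lemma, with the sum over the recolorings [s] taken first.  A
    coloring with [f (i + g) = s (f i)], where [g] divides [n] and
    [s ^ (n / g) = 1], is a closed walk of length [g] in the triangle, closed up
    by [s]: there are [2 ^ g + (-1) ^ g (fix s - 1)] of them.  Summing over [s]
    and over the rotations of each order gives the main sum, plus an error term
    that the sum of the totients of the divisors of [n] prime to [3] evaluates.
    A coloring fixed under [s] and a reflection is a walk of half the length
    whose two ends are fixed or moved by [s] according to parity.  All reflections
    [i |-> - (i + k)] with [k] of the same parity are conjugate, so only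
    [k = 0, 1] matter. *)

Set Implicit Arguments.
Unset Strict Implicit.
Unset Printing Implicit Defensive.

Import GRing.Theory Num.Theory.
Local Open Scope ring_scope.

(** * Walks in the triangle *)

(** The starting vertex [x] is not stored, so a walk of [l] steps is an [l]-tuple. *)
Definition walks (l : nat) (x y : color) : {set l.-tuple color} :=
  [set p : l.-tuple color | path (fun a b => a != b) x p && (last x p == y)].

Lemma sum_tuple_cons (R : nmodType) (T : finType) (l : nat)
    (F : l.+1.-tuple T -> R) :
  \sum_(w : l.+1.-tuple T) F w =
  \sum_(x : T) \sum_(p : l.-tuple T) F [tuple of x :: p].
Proof.
rewrite pair_big (reindex (fun xp : T * l.-tuple T => [tuple of xp.1 :: xp.2])) //.
exists (fun w => (thead w, [tuple of behead w])) => [[x p]|w] _ /=.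
  by congr pair; apply: val_inj.
by rewrite -tuple_eta.
Qed.

Lemma card_walksS (l : nat) (x y : color) :
  (#|walks l.+1 x y|%:R : rat) = \sum_(z | x != z) #|walks l z y|%:R.
Proof.
rewrite -sum1_card natr_sum big_mkcond sum_tuple_cons /= [RHS]big_mkcond.
apply: eq_bigr => z _; rewrite -sum1_card natr_sum /=.
case: (boolP (x != z)) => [xz|xz].
  rewrite [RHS]big_mkcond; apply: eq_bigr => p _.
  by rewrite !inE /= xz.
by apply: big1 => p _; rewrite !inE /= (negPf xz).
Qed.

(** The adjacency matrix of the triangle is [J - I], with [J] the all-ones matrix; its eigenvalues 2
    and -1 give its [l]-th power. The induction splits off the first step. *)
Lemma card_walks (l : nat) (x y : color) :
  (#|walks l x y|%:R : rat) =
  (2 ^+ l - (-1) ^+ l) / 3 + (-1) ^+ l * (x == y)%:R.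
Proof.
elim: l x => [|l IH] x.
  rewrite expr0 subrr mul0r add0r mul1r.
  rewrite -sum1_card natr_sum big_mkcond (bigD1 [tuple]) //= big1 => [|p].
    by rewrite !inE /= addr0; case: eqP.
  by case/eqP; exact: tuple0.
rewrite card_walksS (eq_bigr _ (fun z _ => IH z)) big_split /= sumr_const.
have -> : #|[pred z : color | x != z]| = 2%N.
  transitivity #|predC1 x|; last by rewrite cardC1 card_ord.
  by apply: eq_card => z; rewrite !inE eq_sym.
rewrite -mulr_sumr.
have -> : (\sum_(z | x != z) (z == y)%:R : rat) = 1 - (x == y)%:R.
  case: (eqVneq x y) => [<-|xy].
    by rewrite subrr big1 // => z; rewrite eq_sym => /negPf ->.
  rewrite (bigD1 y) //= eqxx big1 ?addr0 ?subr0 // => z /andP[_ /negPf->] //.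
by rewrite -mulr_natr !exprS; field.
Qed.

(** * The symmetric group on three colors *)

Local Notation c0 := (@Ordinal 3 0 isT).
Local Notation c1 := (@Ordinal 3 1 isT).
Local Notation c2 := (@Ordinal 3 2 isT).

Definition num_fixed (s : {perm color}) : nat := #|[set x | s x == x]|.

Lemma ord3_ind (P : color -> Prop) :
  P c0 -> P c1 -> P c2 -> forall x, P x.
Proof.
move=> P0 P1 P2 [[|[|[|//]]] lt_x3].
- by rewrite (bool_irrelevance lt_x3 isT).
- by rewrite (bool_irrelevance lt_x3 isT).
- by rewrite (bool_irrelevance lt_x3 isT).
Qed.

Lemma num_fixedE (s : {perm color}) :
  num_fixed s = ((s c0 == 0%N :> nat) +
    (s c1 == 1%N :> nat) + (s c2 == 2%N :> nat))%N.
Proof.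
rewrite /num_fixed -sum1_card big_mkcond !big_ord_recl big_ord0 !inE /= addn0 addnA.
have -> : lift ord0 ord0 = c1 by apply: val_inj.
have -> : lift ord0 (lift ord0 ord0) = c2 by apply: val_inj.
have -> : ord0 = c0 by apply: val_inj.
by congr (_ + _ + _)%N; rewrite -val_eqE; case: eqP.
Qed.

(** The identity, the three transpositions and the two 3-cycles: the dihedral group of the triangle
    is the whole symmetric group. *)
Definition perms3 : seq {perm color} :=
  let r := rotation 3 in let t := reflection 3 in
  [:: 1; t; r * t; r * r * t; r; r * r]%g.

Lemma perms3_perm_eq : perm_eq (index_enum {perm color}) perms3.
Proof.
have uniqL : uniq perms3.
  pose val3 (s : {perm color}) := [:: s c0 : nat; s c1 : nat; s c2 : nat].
  by apply: (@map_uniq _ _ val3); rewrite /= /val3 !permM !permE.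
apply: uniq_perm; rewrite ?index_enum_uniq // => s; rewrite mem_index_enum.
have sub_perms3 : {subset perms3 <= index_enum {perm color}}.
  by move=> x _; rewrite mem_index_enum.
have le_size : (size (index_enum {perm color}) <= size perms3)%N.
  by rewrite -[index_enum _]enumT -cardT card_Sn.
have [_ eq_mem] := uniq_min_size uniqL sub_perms3 le_size.
by rewrite eq_mem mem_index_enum.
Qed.

(** The number of fixed points and the order are constant on the three conjugacy classes, of sizes
    1, 3 and 2. *)
Lemma sum_perm3 (F : nat -> nat -> rat) :
  \sum_(s : {perm color}) F (num_fixed s) #[s]%g =
  F 3%N 1%N + 3 * F 1%N 2%N + 2 * F 0%N 3%N.
Proof.
have ord_p (p : nat) (s : {perm color}) : prime p ->
    iter p s =1 id -> num_fixed s != 3%N -> #[s]%g = p.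
  move=> p_pr sp1 fix3; apply: nt_prime_order => //.
    by apply/permP => x; rewrite permX sp1 perm1.
  by apply: contra fix3 => /eqP ->; rewrite num_fixedE !permE.
pose r := rotation 3; pose t := reflection 3.
have fix_t : num_fixed t = 1%N by rewrite num_fixedE !permE.
have fix_rt : num_fixed (r * t)%g = 1%N by rewrite num_fixedE !permM !permE.
have fix_rrt : num_fixed (r * r * t)%g = 1%N.
  by rewrite num_fixedE !permM !permE.
have fix_r : num_fixed r = 0%N by rewrite num_fixedE !permE.
have fix_rr : num_fixed (r * r)%g = 0%N by rewrite num_fixedE !permM !permE.
have fix_1 : num_fixed 1%g = 3%N by rewrite num_fixedE !permE.
have ord_t : #[t]%g = 2%N.
  apply: ord_p; rewrite ?fix_t //.
  by apply: ord3_ind; apply: val_inj; rewrite /= !permE.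
have ord_rt : #[r * t]%g = 2%N.
  apply: ord_p; rewrite ?fix_rt //.
  by apply: ord3_ind; apply: val_inj; rewrite /= !(permM, permE).
have ord_rrt : #[r * r * t]%g = 2%N.
  apply: ord_p; rewrite ?fix_rrt //.
  by apply: ord3_ind; apply: val_inj; rewrite /= !(permM, permE).
have ord_r : #[r]%g = 3%N.
  apply: ord_p; rewrite ?fix_r //.
  by apply: ord3_ind; apply: val_inj; rewrite /= !permE.
have ord_rr : #[r * r]%g = 3%N.
  apply: ord_p; rewrite ?fix_rr //.
  by apply: ord3_ind; apply: val_inj; rewrite /= !(permM, permE).
rewrite (perm_big _ perms3_perm_eq) /perms3 !big_cons big_nil -/r -/t order1.
rewrite ord_t ord_rt ord_rrt ord_r ord_rr fix_1 fix_t fix_rt fix_rrt.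
by rewrite fix_r fix_rr /=; ring.
Qed.

(** * Colorings as periodic sequences and as walks *)

(** As a periodic sequence on the natural numbers, a coloring can be shifted without wrapping
    indices around. *)
Definition unroll (n : nat) (f : {ffun 'I_n.+1 -> color}) (i : nat) : color :=
  f (inord (i %% n.+1)).

Lemma unrollE (n : nat) (f : {ffun 'I_n.+1 -> color}) (i : 'I_n.+1) :
  unroll f i = f i.
Proof. by rewrite /unroll modn_small // inord_val. Qed.

Lemma unrollD (n : nat) (f : {ffun 'I_n.+1 -> color}) (i : nat) :
  unroll f (i + n.+1)%N = unroll f i.
Proof. by rewrite /unroll modnDr. Qed.

Lemma unroll_mod (n : nat) (f : {ffun 'I_n.+1 -> color}) (i : nat) :
  unroll f (i %% n.+1) = unroll f i.
Proof. by rewrite /unroll modn_mod. Qed.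

Lemma unroll_finfun (n : nat) (u : nat -> color) (i : nat) : (i <= n)%N ->
  unroll [ffun j : 'I_n.+1 => u j] i = u i.
Proof. by move=> le_in; rewrite /unroll modn_small // ffunE inordK. Qed.

Lemma colorfulP (n : nat) (f : {ffun 'I_n.+1 -> color}) :
  reflect (forall i, unroll f i != unroll f i.+1) (f \in colorful n.+1).
Proof.
rewrite inE; apply: (iffP forallP) => [Hf i | Hf i].
  have := Hf (inord (i %% n.+1)); rewrite /unroll.
  congr (_ != f _); apply: val_inj => /=.
  by rewrite !inordK ?ltn_pmod // -addn1 modnDml addn1.
have := Hf i; rewrite unrollE /unroll; congr (_ != f _).
by apply: val_inj; rewrite /= inordK ?ltn_pmod.
Qed.

(** The start goes back to the head of the tuple and the end is forced to be its last entry, so the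
    double sum becomes the size of one set, suited to a bijection. *)
Lemma sum_walks (l : nat) (C : rel color) :
  (\sum_x \sum_(y | C x y) #|walks l x y|%:R : rat) =
  #|[set w : l.+1.-tuple color |
      sorted (fun a b => a != b) w & C (thead w) (last (thead w) w)]|%:R.
Proof.
rewrite -[in RHS]sum1_card natr_sum [RHS]big_mkcond sum_tuple_cons /=.
apply: eq_bigr => x _.
under eq_bigr => y _ do rewrite -sum1_card natr_sum big_mkcond.
rewrite exchange_big; apply: eq_bigr => p _ /=.
rewrite inE theadE /= -big_mkcondr (eq_bigl (fun y => (y == last x p) &&
    (path (fun a b => a != b) x p && C x (last x p)))); last first.
  move=> y; rewrite inE (eq_sym (last x p)); case: eqP => [->|_].
    by rewrite andbT andbC.
  by rewrite !andbF.
by rewrite big_mkcondr big_pred1_eq.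
Qed.

(* [E] rebuilds a periodic sequence from its first [l.+1] values. *)
Lemma card_by_walks (n l : nat) (F : {set {ffun 'I_n.+1 -> color}})
    (C : rel color) (E : (nat -> color) -> nat -> color) :
  (forall f, f \in F -> (forall i, (i < l)%N -> unroll f i != unroll f i.+1) /\
                        C (unroll f 0) (unroll f l)) ->
  (forall f i, f \in F -> (i <= n)%N -> E (unroll f) i = unroll f i) ->
  (forall u v i, (forall j, (j <= l)%N -> u j = v j) -> (i <= n)%N ->
                 E u i = E v i) ->
  (forall u, (forall i, (i < l)%N -> u i != u i.+1) -> C (u 0%N) (u l) ->
    [ffun i : 'I_n.+1 => E u i] \in F /\
    forall i, (i <= l)%N -> unroll [ffun i : 'I_n.+1 => E u i] i = u i) ->
  #|F|%:R = \sum_x \sum_(y | C x y) #|walks l x y|%:R :> rat.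
Proof.
move=> FW EF Eloc WF; rewrite sum_walks; congr _%:R.
pose ext (w : l.+1.-tuple color) := [ffun i : 'I_n.+1 => E (nth (thead w) w) i].
set W := [set w | _ & _].
have walkW w : w \in W -> (forall i, (i < l)%N ->
    nth (thead w) w i != nth (thead w) w i.+1) /\
    C (nth (thead w) w 0) (nth (thead w) w l).
  rewrite inE => /andP[/(sortedP (thead w)) sw].
  rewrite -nth_last size_tuple /= -[nth _ w 0](tnth_nth _ _ ord0) -/(thead w).
  by split=> // i lt_il; apply: sw; rewrite size_tuple.
(* Onto: [FW] makes the first [l.+1] values of [f] a walk, and [EF] with [Eloc] rebuilds [f] from
   them. *)
have -> : F = ext @: W.
  apply/setP => f; apply/idP/imsetP => [Ff | [w Ww ->]]; last first.
    by have [uw Cw] := walkW w Ww; have [] := WF _ uw Cw.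
  have size_w : size (mkseq (unroll f) l.+1) == l.+1 by rewrite size_mkseq.
  have [uf Cf] := FW f Ff.
  exists (Tuple size_w).
    rewrite inE; apply/andP; split.
      apply/(sortedP (unroll f 0)) => i; rewrite size_tuple ltnS => lt_il.
      by rewrite !nth_mkseq ?uf // ltnS ltnW.
    rewrite -nth_last size_tuple /= [thead _](tnth_nth (unroll f 0)) /=.
    by rewrite nth_mkseq.
  apply/ffunP => i; rewrite ffunE -unrollE -(EF _ _ Ff) ?leq_ord //.
  by apply: Eloc => [j le_jl|]; rewrite ?leq_ord ?nth_mkseq.
(* One-to-one: by [WF] the walk can be read off its extension. *)
apply: card_in_imset => w1 w2 /walkW[u1 C1] /walkW[u2 C2] eq_ext.
have [_ E1] := WF _ u1 C1; have [_ E2] := WF _ u2 C2.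
apply/val_inj/(@eq_from_nth _ (thead w1)); rewrite ?size_tuple // => i lt_i.
rewrite -E1 // [LHS](congr1 (fun f => unroll f i) eq_ext) E2 //.
by apply: set_nth_default; rewrite size_tuple.
Qed.

(** * Colorings fixed by a rotation *)

Definition fixed (n : nat) (s : {perm color}) (t : {perm 'I_n}) :
  {set {ffun 'I_n -> color}} :=
  ('Fix_(colorful n | recolor_action n)[(s, t)])%g.

Lemma fixedP (n : nat) (s : {perm color}) (t : {perm 'I_n}) f :
  reflect (f \in colorful n /\ forall i, f (t i) = s (f i)) (f \in fixed s t).
Proof.
rewrite /fixed in_setI; apply: (iffP andP) => -[Cf Hf]; split=> //.
  move=> i; move/afix1P: Hf => /= {1}<-.
  by rewrite ffunE /= permK.
apply/afix1P/ffunP => i /=; rewrite ffunE /=.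
by rewrite -Hf permKV.
Qed.

Lemma rotationXE (n k : nat) (i : 'I_n.+1) :
  (rotation n.+1 ^+ k)%g i = ((i + k) %% n.+1)%N :> nat.
Proof.
rewrite permX; elim: k => [|k IH] /=; first by rewrite addn0 modn_small.
by rewrite permE /= IH -addn1 modnDml addn1 addnS.
Qed.

Lemma fixed_rotationP (n k : nat) (s : {perm color}) f :
  reflect (f \in colorful n.+1 /\
           forall i, unroll f (i + k)%N = s (unroll f i))
    (f \in fixed s (rotation n.+1 ^+ k)%g).
Proof.
apply: (iffP (fixedP _ _ _)) => -[Cf Hf]; split=> // i; last first.
  by rewrite -unrollE rotationXE unroll_mod Hf unrollE.
pose io := Ordinal (ltn_pmod i (ltn0Sn n)).
have -> : unroll f (i + k)%N = unroll f ((rotation n.+1 ^+ k)%g io).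
  by rewrite rotationXE unroll_mod /= -[RHS]unroll_mod modnDml unroll_mod.
by rewrite unrollE Hf -unrollE /= unroll_mod.
Qed.

(** The permutation is [i |-> - (i + e)]; the divisibility says, without subtraction, that [j] is
    the image of [i] modulo [n.+1]. *)
Lemma fixed_reflectionP (n e : nat) (s : {perm color}) f :
  reflect (f \in colorful n.+1 /\
      forall i j, (n.+1 %| i + j + e)%N -> unroll f j = s (unroll f i))
    (f \in fixed s (rotation n.+1 ^+ e * reflection n.+1)%g).
Proof.
have reflE (i : 'I_n.+1) :
    (n.+1 %| i + (rotation n.+1 ^+ e * reflection n.+1)%g i + e)%N.
  rewrite permM permE /= rotationXE addnAC /dvdn -modnDml.
  by rewrite modnDmr subnKC ?modnn // ltnW // ltn_pmod.
apply: (iffP (fixedP _ _ _)) => -[Cf Hf]; split=> // i; last first.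
  by rewrite -!unrollE (Hf i).
move=> j dvd_ij; pose io := Ordinal (ltn_pmod i (ltn0Sn n)).
rewrite -[in RHS]unroll_mod -[(i %% _)%N]/(io : nat) unrollE -Hf -unrollE.
rewrite -[LHS]unroll_mod -[RHS]unroll_mod; congr unroll.
apply/eqP; rewrite -(eqn_modDl (io + e)); apply/eqP.
rewrite [in LHS]addnAC [in RHS]addnAC (eqP (reflE io)).
by rewrite -addnA modnDml addnA (eqP dvd_ij).
Qed.

(** Adjacent beads show two distinct colors, both fixed by [s]; the third color is then fixed as
    well. *)
Lemma fixed1 (n : nat) (s : {perm color}) f :
  f \in fixed s (1%g : {perm 'I_n.+1}) -> s = 1%g.
Proof.
case/fixedP=> /colorfulP/(_ 0%N) f01 Hf; apply/permP => x; rewrite perm1.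
have sf i : s (unroll f i) = unroll f i by rewrite {1}/unroll -Hf perm1.
have [->|x0] := eqVneq x (unroll f 0); first exact: sf.
have [->|x1] := eqVneq x (unroll f 1); first exact: sf.
have sx0 : s x != unroll f 0 by rewrite -(sf 0%N) (inj_eq perm_inj).
have sx1 : s x != unroll f 1 by rewrite -(sf 1%N) (inj_eq perm_inj).
move: f01 x0 x1 sx0 sx1; move: (s x) (unroll f 0) (unroll f 1).
do 3![elim/ord3_ind]; move: x; elim/ord3_ind => //; exact: val_inj.
Qed.

Lemma fixedX (n k : nat) (s : {perm color}) (t : {perm 'I_n}) :
  fixed s t \subset fixed (s ^+ k)%g (t ^+ k)%g.
Proof.
apply/subsetP => f /fixedP[Cf Hf]; apply/fixedP; split=> // i.
by rewrite !permX; elim: k => //= k <-.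
Qed.

(** A coloring fixed by [(s, t)] is fixed by [(s ^+ k, 1)], which forces [s ^+ k = 1]. This discards
    the recolorings whose order does not divide [k]. *)
Lemma fixed_eq0 (n k : nat) (s : {perm color}) (t : {perm 'I_n.+1}) :
  (t ^+ k = 1)%g -> (s ^+ k != 1)%g -> fixed s t = set0.
Proof.
move=> tk1 sk1; apply/setP => f; rewrite in_set0; apply/negbTE/negP.
move/(subsetP (fixedX k s t)); rewrite tk1 => /fixed1 sk.
by rewrite sk eqxx in sk1.
Qed.

Lemma card_fixed_rotation (n g : nat) (s : {perm color}) :
  (g %| n.+1)%N -> (s ^+ (n.+1 %/ g) = 1)%g ->
  #|fixed s (rotation n.+1 ^+ g)%g|%:R =
  2 ^+ g + (-1) ^+ g * ((num_fixed s)%:R - 1) :> rat.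
Proof.
move=> dvd_g sd1; have g_gt0 : (0 < g)%N by apply: dvdn_gt0 dvd_g.
(* The walk [u] from [u 0] to [s (u 0)] gives the first block of [g] beads; block number [q] is this
   one recolored by [s ^+ q]. *)
rewrite (@card_by_walks n g _ (fun x y => s x == y)
    (fun u i => (s ^+ (i %/ g))%g (u (i %% g)%N))).
- under eq_bigr => x _.
    rewrite (eq_bigl (pred1 (s x))) => [|y]; last by rewrite /= eq_sym.
    rewrite big_pred1_eq card_walks; over.
  rewrite big_split /= sumr_const card_ord -mulr_sumr.
  have -> : \sum_x (x == s x)%:R = (num_fixed s)%:R :> rat.
    rewrite /num_fixed -sum1_card natr_sum [RHS]big_mkcond.
    by apply: eq_bigr => x _; rewrite inE eq_sym; case: eqP.
  by rewrite -mulr_natr; field.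
- move=> f /fixed_rotationP[/colorfulP Cf Hf]; split=> [i _|]; first exact: Cf.
  by rewrite -Hf.
- move=> f i /fixed_rotationP[_ Hf] _; rewrite [in RHS](divn_eq i g).
  elim: (i %/ g)%N => [|q IH]; first by rewrite perm1.
  by rewrite expgSr permM IH -Hf addnC addnA -mulSn.
- move=> u v i uv _; congr (_ _); apply: uv; exact/ltnW/ltn_pmod.
move=> u u_neq /eqP u_g; pose E i := (s ^+ (i %/ g))%g (u (i %% g)%N).
pose f := [ffun i : 'I_n.+1 => E i].
suff : f \in fixed s (rotation n.+1 ^+ g)%g /\
       forall i, (i <= g)%N -> unroll f i = u i by [].
have ED i : E (i + g)%N = s (E i).
  by rewrite /E modnDr divnDr ?dvdnn // divnn g_gt0 addn1 expgSr permM.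
(* Period [n.+1]: this is where [s ^+ (n.+1 %/ g) = 1] enters. *)
have EN q i : E (q * n.+1 + i)%N = E i.
  rewrite /E -{1 2}(divnK dvd_g) mulnA divnMDl // modnMDl.
  by rewrite expgD mulnC expgM sd1 expg1n mul1g.
have fE i : unroll f i = E i.
  rewrite -unroll_mod (unroll_finfun E); last by rewrite -ltnS ltn_pmod.
  by rewrite -(EN (i %/ n.+1)%N) -divn_eq.
have Eu i : (i <= g)%N -> E i = u i.
  rewrite leq_eqVlt => /predU1P[-> | lt_ig].
    by rewrite /E divnn g_gt0 modnn.
  by rewrite /E divn_small // modn_small // perm1.
split=> [|i le_ig]; last by rewrite fE Eu.
apply/fixed_rotationP; split=> [|i]; last by rewrite !fE ED.
(* A shift by [g] applies the injective [s] to both neighbors, so only the first block needs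
   checking; its last bead is followed by [u g = s (u 0)]. *)
apply/colorfulP => i; rewrite !fE (divn_eq i g) addnC; elim: (i %/ g)%N => [|q IH].
  have lt_ig := ltn_pmod i g_gt0.
  by rewrite addn0 !Eu ?u_neq // ltnW.
by rewrite mulSn addnCA addnC -addSn !ED (inj_eq perm_inj).
Qed.

(** * Colorings fixed by a reflection *)

Lemma colorful_ltP (n : nat) (f : {ffun 'I_n.+1 -> color}) :
  (forall i, (i < n)%N -> unroll f i != unroll f i.+1) ->
  unroll f n != unroll f 0 -> f \in colorful n.+1.
Proof.
move=> Hf Hn; apply/colorfulP => i.
rewrite -unroll_mod -[unroll f i.+1]unroll_mod -(addn1 i) -modnDml addn1.
have := ltn_pmod i (ltn0Sn n); move: (i %% _)%N => {}i.
rewrite ltnS leq_eqVlt => /predU1P[-> | lt_in]; first by rewrite modnn.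
by rewrite modn_small ?Hf.
Qed.

(** The beads 0 to [l] run from one end of the mirror axis to the other. At each end the axis passes
    either through a bead, whose color [s] must fix, or between two adjacent beads swapped by the
    reflection, whose colors [s] must move. *)
Lemma card_fixed_reflection_walks (n : nat) (e : bool) (s : {perm color}) :
  (0 < n)%N -> (s ^+ 2 = 1)%g ->
  #|fixed s (rotation n.+1 ^+ e * reflection n.+1)%g|%:R =
  \sum_x \sum_(y | ((s x == x) == ~~ e) && ((s y == y) == ~~ odd (n.+1 - e)))
    #|walks (n.+1 - e)./2 x y|%:R :> rat.
Proof.
move=> n_gt0 ss1; set l := (_./2).
have ssK x : s (s x) = x.
  by have := congr1 (fun t : {perm color} => t x) ss1; rewrite permX perm1.
(* A bead [i] beyond [l] gets the color of its mirror image [n.+1 - e - i], recolored by [s]. *)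
apply: (@card_by_walks n l _ _
  (fun u i => if (i <= l)%N then u i else s (u (n.+1 - e - i)%N))).
- move=> f /fixed_reflectionP[/colorfulP Cf Hf]; split=> [i _|]; first exact: Cf.
  apply/andP; split.
    case: e @l Hf => l Hf /=; last by rewrite -(Hf 0%N 0%N) ?eqxx.
    rewrite -(Hf 0%N n) ?add0n ?addn1 // -(unrollD f 0) add0n.
    by rewrite (negPf (Cf n)).
  have [odd_ne | even_ne] := boolP (odd _).
    have dvd_l : (n.+1 %| l + l.+1 + e)%N.
      by rewrite (_ : (l + l.+1 + e = n.+1)%N) //; rewrite /l; lia.
    by rewrite -(Hf _ _ dvd_l) (eq_sym (unroll f l.+1)) (negPf (Cf l)).
  have dvd_l : (n.+1 %| l + l + e)%N.
    by rewrite (_ : (l + l + e = n.+1)%N) //; rewrite /l; lia.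
  by rewrite -(Hf _ _ dvd_l) eqxx.
- move=> f i /fixed_reflectionP[_ Hf] le_in; case: leqP => // lt_li.
  rewrite -(Hf _ i) //.
  by rewrite (_ : (n.+1 - e - i + i + e = n.+1)%N) //; rewrite /l; lia.
- move=> u v i uv le_in; case: leqP => [|lt_li]; first exact: uv.
  by rewrite uv // /l; lia.
move=> u u_neq /andP[/eqP C0 /eqP Cl];
pose E i := if (i <= l)%N then u i else s (u (n.+1 - e - i)%N).
pose f := [ffun i : 'I_n.+1 => E i].
suff : f \in fixed s (rotation n.+1 ^+ e * reflection n.+1)%g /\
       forall i, (i <= l)%N -> unroll f i = u i by [].
have fE i : (i <= n)%N -> unroll f i = E i by move=> le_in; rewrite unroll_finfun.
have Eu i : (i <= l)%N -> E i = u i by rewrite /E => ->.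
have Es i : (l < i)%N -> E i = s (u (n.+1 - e - i)%N).
  by rewrite /E ltnNge => /negPf ->.
have le_ln : (l <= n)%N by rewrite /l; lia.
split=> [|i le_il]; last by rewrite fE ?Eu // (leq_trans le_il).
apply/fixed_reflectionP; split=> [|i j].
  apply: colorful_ltP => [i lt_in|].
    rewrite !fE // 1?ltnW //; have [lt_il|le_li] := ltnP i l.
      by rewrite !Eu ?u_neq // ltnW.
    (* Crossing the middle from [l]: for odd [n.+1 - e], bead [l.+1] mirrors [l], whose color [s]
       moves; otherwise it mirrors [l - 1], and [s] fixes the color of [l]. *)
    rewrite [E i.+1]Es //; move: le_li; rewrite leq_eqVlt => /predU1P[<- | lt_li].
      rewrite Eu //; have [odd_ne | even_ne] := boolP (odd (n.+1 - e)).
        rewrite (_ : (n.+1 - e - l.+1 = l)%N); last by rewrite /l; lia.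
        by rewrite eq_sym Cl odd_ne.
      have ul : s (u l) = u l by apply/eqP; rewrite Cl even_ne.
      rewrite -[in X in X != _]ul (inj_eq perm_inj) eq_sym.
      have El : (n.+1 - e - l.+1).+1 = l by rewrite /l; lia.
      by have := u_neq (n.+1 - e - l.+1)%N; rewrite El; apply; lia.
    rewrite Es // (inj_eq perm_inj) eq_sym.
    rewrite (_ : n.+1 - e - i = (n.+1 - e - i.+1).+1)%N ?u_neq //; last first.
      by rewrite /l; lia.
    by rewrite /l; lia.
  (* The closing edge from [n] to 0. The case [n <= l] happens only for [n = 1]; otherwise bead [n]
     mirrors bead 0 if [e] holds and bead 1 if not. *)
  rewrite !fE // [E 0%N]Eu //; have [le_nl | lt_ln] := leqP n l.
    rewrite Eu // eq_sym (_ : n = 1%N) ?u_neq //; move: le_nl; rewrite /l; lia.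
  rewrite Es //; have [e1 | e0] := boolP e.
    by rewrite subSS subn0 subnn C0 e1.
  have u0 : s (u 0%N) = u 0%N by apply/eqP; rewrite C0 e0.
  rewrite subn0 subSnn -[in X in _ != X]u0 (inj_eq perm_inj) eq_sym.
  by rewrite u_neq // /l; lia.
rewrite -[unroll f j]unroll_mod -[unroll f i]unroll_mod => dvd_ij.
have {dvd_ij} : (n.+1 %| i %% n.+1 + j %% n.+1 + e)%N.
  by rewrite /dvdn -modnDml modnDm modnDml.
have := ltn_pmod i (ltn0Sn n); have := ltn_pmod j (ltn0Sn n).
move: (i %% _)%N (j %% _)%N => {}i {}j; rewrite !ltnS => le_jn le_in dvd_ij.
rewrite !fE //.
(* With [i, j <= n] and [e <= 1], the sum is below [2 * n.+1]. *)
have : (i + j + e = 0)%N \/ (i + j + e = n.+1)%N.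
  case/dvdnP: dvd_ij => -[|[|q]] Dij; [by left | by right; rewrite Dij mul1n |].
  have : (2 * n.+1 <= i + j + e)%N by rewrite Dij leq_mul2r orbT.
  by lia.
case=> eq_ij.
  have [-> ->] : i = 0%N /\ j = 0%N by lia.
  rewrite Eu //; apply/esym/eqP; rewrite C0; case: (e) eq_ij => //; lia.
have [le_il|lt_li] := leqP i l.
  rewrite [E i]Eu //; have [le_jl|lt_lj] := leqP j l.
    have [-> ->] : i = l /\ j = l by rewrite /l in le_il le_jl *; lia.
    by rewrite Eu //; apply/esym/eqP; rewrite Cl /l in le_il le_jl *; lia.
  by rewrite Es //; congr (s (u _)); lia.
rewrite [E i]Es // ssK Eu; last by rewrite /l in lt_li *; lia.
by congr u; lia.
Qed.

Definition fixed_sum (n : nat) (t : {perm 'I_n}) : rat :=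
  \sum_(s : {perm color}) #|fixed s t|%:R.

Lemma sum_indicator (T : finType) (P : pred T) :
  \sum_x (P x)%:R = #|P|%:R :> rat.
Proof.
rewrite -sum1_card natr_sum [RHS]big_mkcond.
by apply: eq_bigr => x _; rewrite unfold_in; case: (P x).
Qed.

(** [card_walks] is a constant plus a multiple of the identity matrix: the constant part factors
    over [P] and [Q], the diagonal part sees only the colors in both. *)
Lemma sum_walks_pred (l : nat) (P Q : pred color) :
  \sum_x \sum_(y | P x && Q y) #|walks l x y|%:R =
  (2 ^+ l - (-1) ^+ l) / 3 * #|P|%:R * #|Q|%:R + (-1) ^+ l * #|predI P Q|%:R
  :> rat.
Proof.
rewrite -!sum_indicator -mulrA mulr_suml !mulr_sumr -big_split /=.
apply: eq_bigr => x _; rewrite big_mkcond /=.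
transitivity (\sum_y ((2 ^+ l - (-1) ^+ l) / 3 * ((P x)%:R * (Q y)%:R) +
    (-1) ^+ l * (P x && Q y)%:R * (x == y)%:R) : rat).
  apply: eq_bigr => y _; rewrite card_walks.
  by case: (P x); case: (Q y); rewrite /= ?(mulr0, mul0r, mulr1, mul1r, addr0).
rewrite big_split /= -mulr_sumr -mulr_sumr; congr (_ + _).
rewrite (bigD1 x) //= eqxx mulr1 big1 ?addr0 // => y.
by rewrite eq_sym => /negPf ->; rewrite mulr0.
Qed.

Lemma card_parity_fixed (s : {perm color}) (b : bool) :
  #|[pred x | (s x == x) == b]| = if b then num_fixed s else (3 - num_fixed s)%N.
Proof.
case: b.
  by rewrite /num_fixed cardsE; apply: eq_card => x; rewrite !inE eqb_id.
have := cardC [pred x | s x == x]; rewrite card_ord /num_fixed cardsE.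
move=> /(canRL (addKn _)) <-.
by apply: eq_card => x; rewrite !inE eqbF_neg.
Qed.

Lemma rotation_reflection (n : nat) :
  (rotation n * reflection n * rotation n = reflection n)%g.
Proof. by apply/permP => i; rewrite !permM !permE ordS_opp. Qed.

Lemma reflectionK (n : nat) : (reflection n * reflection n = 1)%g.
Proof. by apply/permP => i; rewrite permM !permE ord_oppK. Qed.

(** A reflection squares to 1, so only the identity and the transpositions contribute; a
    transposition fixes one color and moves two. *)
Lemma fixed_sum_reflection (n : nat) (e : bool) : (0 < n)%N ->
  let l := (n.+1 - e)./2 in
  let c : rat := (2 ^+ l - (-1) ^+ l) / 3 in
  fixed_sum (rotation n.+1 ^+ e * reflection n.+1)%g =
  if odd (n.+1 - e) then
    if e then 3 * (4 * c + 2 * (-1) ^+ l) else 6 * c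
  else if e then 6 * c else 12 * c + 6 * (-1) ^+ l.
Proof.
move=> n_gt0 l c; set N := (n.+1 - e)%N.
pose A (b : bool) k : rat := (if b then k else 3 - k)%N%:R.
(* The two end conditions coincide when [e == odd N] and exclude each other otherwise. *)
pose F k o : rat := if (o %| 2)%N then
  c * A (~~ e) k * A (~~ odd N) k + (-1) ^+ l *
    (if e == odd N then A (~~ e) k else 0) else 0.
transitivity (\sum_(s : {perm color}) F (num_fixed s) #[s]%g).
  apply: eq_bigr => s _; rewrite /F order_dvdn; case: eqP => [ss1 | ss1].
    rewrite card_fixed_reflection_walks //.
    rewrite (sum_walks_pred _ [pred x | (s x == x) == ~~ e]
      [pred x | (s x == x) == ~~ odd N]) !card_parity_fixed.
    congr (_ + _ * _); case: eqP => [<-|/eqP ne_e].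
      rewrite /A -card_parity_fixed; congr _%:R.
      by apply: eq_card => x; rewrite !inE andbb.
    rewrite eq_card0 // => x; rewrite !inE; apply/negP => /andP[/eqP ->].
    by move: ne_e; case: (e); case: (odd N).
  rewrite (@fixed_eq0 n 2) ?cards0 //; last exact/eqP.
  case: (e); last by rewrite expg0 mul1g expgS expg1 reflectionK.
  by rewrite expg1 expgS expg1 mulgA rotation_reflection reflectionK.
rewrite sum_perm3 /F /A /=.
case: (e); case: (odd N) => /=; rewrite ?subnn ?subn1 /=; ring.
Qed.

Lemma fixed_sum_reflections (n : nat) : (0 < n)%N ->
  fixed_sum (reflection n.+1) + fixed_sum (rotation n.+1 * reflection n.+1)%g =
  12 * reflection_term n.+1.
Proof.
move=> n_gt0; have := fixed_sum_reflection false n_gt0.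
rewrite expg0 mul1g => ->; have := fixed_sum_reflection true n_gt0.
rewrite expg1 => ->; rewrite subn0 subn1 /= /reflection_term /=.
(* The half-walks for [e = 0] and [e = 1] have equal lengths for even [n], and lengths differing by
   one for odd [n]. *)
case: (boolP (odd n)) => /= odd_n; last first.
  have -> : uphalf n = n./2 by lia.
  by field.
have -> : uphalf n = n./2.+1 by lia.
by rewrite /= !exprS; field.
Qed.

(** * Sums over the cyclic and dihedral groups *)

Lemma rotationX_eq1 (n k : nat) : (rotation n.+1 ^+ k == 1)%g = (n.+1 %| k)%N.
Proof.
apply/eqP/idP => [rk1 | dvd_k].
  by rewrite /dvdn -(rotationXE k (@ord0 n)) rk1 perm1.
apply/permP => i; rewrite perm1; apply: val_inj; rewrite /= rotationXE.
by rewrite -modnDmr (eqP dvd_k) addn0 modn_small.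
Qed.

Lemma order_rotation (n : nat) : #[rotation n.+1]%g = n.+1.
Proof.
apply/eqP; rewrite eqn_dvd order_dvdn rotationX_eq1 dvdnn /=.
by rewrite -rotationX_eq1 expg_order.
Qed.

Lemma sum_cycle (R : nmodType) (gT : finGroupType) (x : gT) (F : gT -> R) :
  \sum_(t in <[x]>%g) F t = \sum_(k < #[x]%g) F (x ^+ k)%g.
Proof.
pose h (k : 'I_#[x]%g) := (x ^+ k)%g.
have -> : <[x]>%g = h @: [set: 'I_#[x]%g].
  apply/setP => t; apply/idP/imsetP => [/cyclePmin[k lt_k ->] | [k _ ->]].
    by exists (Ordinal lt_k).
  exact: mem_cycle.
rewrite big_imset /= => [|k1 k2 _ _ /eqP].
  by apply: eq_bigl => k; rewrite inE.
by rewrite eq_expg_mod_order !modn_small // => /eqP/val_inj.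
Qed.

(** The action of [(1, u)] carries one fixed set injectively into the other; [u^-1] will give the
    converse inequality. *)
Lemma leq_card_fixedJ (n : nat) (s : {perm color}) (t u : {perm 'I_n}) :
  (1%g, u) \in bracelet_group n -> (#|fixed s t| <= #|fixed s (t ^ u)%g|)%N.
Proof.
move=> Gu; rewrite -(card_imset _ (act_inj (recolor_action n) (1%g, u))).
apply/subset_leq_card/subsetP => _ /imsetP[f /fixedP[Cf Hf] ->].
apply/fixedP; split=> [|i]; first by rewrite (actsP (recolor_acts n)).
rewrite !ffunE /= !perm1 -Hf; congr (f _).
by rewrite conjgE !permM permK.
Qed.

Lemma fixed_sumJ (n : nat) (t u : {perm 'I_n}) :
  (1%g, u) \in bracelet_group n -> fixed_sum (t ^ u)%g = fixed_sum t.
Proof.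
move=> Gu; apply: eq_bigr => s _; congr _%:R; apply/eqP.
rewrite eqn_leq leq_card_fixedJ // andbT -{2}(conjgK u t).
by apply: leq_card_fixedJ; rewrite -[1%g]invg1 -[(_, _)]/((1, u)^-1)%g groupV.
Qed.

Lemma rotation_bracelet (n : nat) : (1%g, rotation n) \in bracelet_group n.
Proof. by rewrite in_setX in_setT mem_gen // !inE eqxx. Qed.

(** Since [r * t = t * r^-1], conjugating [r ^+ k * t] by [r^-1] adds 2 to the exponent. *)
Lemma fixed_sum_rotX2 (n k : nat) :
  fixed_sum (rotation n.+1 ^+ k.+2 * reflection n.+1)%g =
  fixed_sum (rotation n.+1 ^+ k * reflection n.+1)%g.
Proof.
set r := rotation _; set t := reflection _.
have rtr : (r * t * r = t)%g := rotation_reflection _.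
have tr : (r * t = t * r^-1)%g by rewrite -[in RHS]rtr mulgK.
have -> : (r ^+ k.+2 * t = (r ^+ k * t) ^ r^-1)%g.
  by rewrite conjgE invgK expgSr -mulgA tr expgS !mulgA.
apply: fixed_sumJ; rewrite -[1%g]invg1 -[(_, _)]/((1, r)^-1)%g groupV.
exact: rotation_bracelet.
Qed.

Lemma sum_fixed_sum_reflection (n : nat) : (0 < n)%N ->
  \sum_(t in <[rotation n.+1]>%g) fixed_sum (t * reflection n.+1)%g =
  6 * n.+1%:R * reflection_term n.+1.
Proof.
move=> n_gt0; rewrite sum_cycle order_rotation.
pose X k := fixed_sum (rotation n.+1 ^+ k * reflection n.+1)%g.
have X01 : X 0%N + X 1%N = 12 * reflection_term n.+1.
  by rewrite /X expg0 expg1 mul1g fixed_sum_reflections.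
have XS k : X k + X k.+1 = X 0%N + X 1%N.
  by elim: k => // k <-; rewrite addrC {1}/X fixed_sum_rotX2.
(* [X] has period 2 but [n.+1] may be odd, so the terms cannot simply be paired off: the sum is
   added to its own shift, which gives [X k + X k.+1] at each [k]. *)
have shift : \sum_(k < n.+1) X k.+1 = \sum_(k < n.+1) X k.
  rewrite big_ord_recr [RHS]big_ord_recl /= addrC; congr (_ + _).
  by rewrite /X -[X in (_ ^+ X)%g](order_rotation n) expg_order expg0.
suff : 2 * \sum_(k < n.+1) X k = n.+1%:R * (12 * reflection_term n.+1).
  rewrite /X => E; apply: (@mulfI _ 2%:R) => //; rewrite E; ring.
rewrite mulr_natl mulr2n -{2}shift -big_split /= -X01.
by under eq_bigr => k _ do rewrite XS; rewrite sumr_const card_ord mulr_natl.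
Qed.

(** A rotation that fixes 0 is the identity, whereas the reflection moves 1 when there are at least
    three beads. *)
Lemma reflection_notin_rotations (n : nat) : (1 < n)%N ->
  (reflection n.+1 \notin <[rotation n.+1]>)%g.
Proof.
move=> n_gt1; apply/negP => /cycleP[k rk].
have := congr1 (fun p : {perm 'I_n.+1} => (p ord0 : nat)) rk.
rewrite rotationXE permE /= subn0 modnn add0n => /esym/eqP dvd_k.
have := congr1 (fun p : {perm 'I_n.+1} => (p (inord 1) : nat)) rk.
have -> : (rotation n.+1 ^+ k = 1)%g by apply/eqP; rewrite rotationX_eq1.
rewrite perm1 permE /= inordK; last lia.
by rewrite modn_small; lia.
Qed.

(** The reflection has order 2 and normalizes the rotations, so the group is the disjoint union of
    the rotations and one further coset. *)
Lemma sum_dihedral (R : nmodType) (n : nat) (F : {perm 'I_n.+1} -> R) :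
  (1 < n)%N ->
  \sum_(t in <<[set rotation n.+1; reflection n.+1]>>%g) F t =
  \sum_(t in <[rotation n.+1]>%g) F t +
  \sum_(t in <[rotation n.+1]>%g) F (t * reflection n.+1)%g.
Proof.
move=> n_gt1; have r'u := reflection_notin_rotations n_gt1.
move: (rotation_reflection n.+1) (reflectionK n.+1) r'u.
set r := rotation _; set u := reflection _ => rur uu r'u.
have uV : (u^-1 = u)%g by apply/eqP; rewrite eq_invg_mul uu.
have nru : (u \in 'N(<[r]>))%g.
  apply/normP; rewrite -cycleJ -[in RHS]cycleV; congr <[_]>%g.
  by apply: (mulgI r); rewrite mulgV conjgE uV !mulgA rur.
have -> : (<<[set r; u]>> = <[r]> :|: <[r]> :* u)%g.
  have -> : (<<[set r; u]>> = <[r]> * <[u]>)%g.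
    rewrite -norm_joinEr ?cycle_subG //; apply/eqP; rewrite eqEsubset.
    rewrite gen_subG join_subG !cycle_subG subUset !sub1set.
    by rewrite !mem_gen // !inE ?cycle_id ?eqxx ?orbT.
  have -> : (<[u]> = [set 1; u])%g.
    apply/cycle2g/nt_prime_order => //.
    by apply: contra r'u => /eqP ->.
  by rewrite mulgU mulg1.
rewrite (eq_bigl [predU <[r]>%g & (<[r]> :* u)%g]) => [|t]; last by rewrite !inE.
rewrite bigU /=; last first.
  rewrite disjoints_subset; apply/subsetP => t rt; rewrite inE mem_rcoset.
  by rewrite groupMl // groupV.
congr (_ + _); rewrite -rcosetE.
by rewrite big_imset //= => x y _ _; apply: mulIg.
Qed.

(** Burnside's lemma; 6 is the order of the color group. *)
Lemma burnside_recolor (n : nat) (D : {group {perm 'I_n}}) :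
  (setX [set: {perm color}] D \subset bracelet_group n)%g ->
  #|orbit (recolor_action n) (setX [set: {perm color}] D) @: colorful n|%:R *
    (6 * #|D|%:R) = \sum_(t in D) fixed_sum t :> rat.
Proof.
move=> sDG.
have /Frobenius_Cauchy : [acts setX_group [group of [set: {perm color}]] D,
    on colorful n | recolor_action n].
  by apply: subset_trans (recolor_acts n).
rewrite /= cardsX cardsT card_Sn.
move/(congr1 (fun m : nat => m%:R : rat)); rewrite !natrM => <-.
rewrite natr_sum exchange_big pair_big /=.
by apply: eq_big => [[s t]|[s t] _] //=; rewrite ?in_setX ?in_setT.
Qed.

(** * Summation by order *)

(* If [a = b ^+ u], then [s |-> s ^+ u] permutes the [s] of order dividing that of
   [b], and [(s, b)] and [(s ^+ u, a)] generate the same group. *)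
Lemma fixed_sum_cycle (n : nat) (a b : {perm 'I_n.+1}) :
  (<[a]> = <[b]>)%g -> fixed_sum a = fixed_sum b.
Proof.
move=> eq_ab; have oab : #[a]%g = #[b]%g by rewrite /order eq_ab.
have /cycleP[u Da] : (a \in <[b]>)%g by rewrite -eq_ab cycle_id.
have /cycleP[m Db] : (b \in <[a]>)%g by rewrite eq_ab cycle_id.
have sum_ord (t : {perm 'I_n.+1}) : fixed_sum t =
    \sum_(s : {perm color} | (s ^+ #[t] == 1)%g) #|fixed s t|%:R.
  rewrite /fixed_sum [RHS]big_mkcond; apply: eq_bigr => s _.
  case: ifPn => // s1; rewrite (@fixed_eq0 n #[t]%g) ?cards0 //.
  exact: expg_order.
(* Thus raising to the power [u] and to the power [m] are mutually inverse on the [s] whose order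
   divides that of [b]. *)
have um1 : (u * m = 1 %[mod #[b]%g])%N.
  by apply/eqP; rewrite -eq_expg_mod_order expg1 expgM -Da -Db.
have expK (s : {perm color}) : (s ^+ #[b] = 1)%g -> (s ^+ u ^+ m = s)%g.
  move=> s1; rewrite -expgM -[RHS]expg1; apply/eqP.
  rewrite eq_expg_mod_order; apply/eqP.
  have dvd_s : (#[s]%g %| #[b]%g)%N by rewrite order_dvdn s1.
  by rewrite -(modn_dvdm _ dvd_s) um1 modn_dvdm.
rewrite !sum_ord oab.
rewrite (reindex_onto (fun s : {perm color} => (s ^+ u)%g)
                      (fun s : {perm color} => (s ^+ m)%g)); last first.
  by move=> s /eqP s1; rewrite -expgM mulnC expgM expK.
apply: eq_big => s.
  apply/andP/eqP => [[/eqP s1 /eqP <-] | s1].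
    by rewrite -expgM mulnC expgM s1 expg1n.
  by rewrite expK // -expgM mulnC expgM s1 expg1n !eqxx.
case/andP=> _ /eqP sum_s; congr _%:R; apply/eqP; rewrite eqn_leq.
(* The pair [(s, b)] is the [m]-th power of [(s ^+ u, a)], which is in turn the [u]-th power of
   [(s, b)]. *)
apply/andP; split; apply: subset_leq_card.
  by rewrite -[X in fixed X b]sum_s [X in _ \subset fixed _ X]Db fixedX.
by rewrite Da fixedX.
Qed.

(** This is the number of color permutations [s] with [s ^+ d = 1]: 1, plus 3 if 2 divides [d], plus
    2 if 3 divides [d]. *)
Definition necklace_coef (d : nat) : rat :=
  (1 + ((2 %| d) && ~~ (3 %| d))%N%:R) * (gcdn d 6)%:R.

(** The coefficient of [(-1) ^+ g] sums [num_fixed s - 1] over the [s] with [s ^+ d = 1]: 2 from the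
    identity, 0 from a transposition, -1 from each 3-cycle. *)
Lemma fixed_sum_rotation (n g : nat) : (g %| n.+1)%N ->
  let d := (n.+1 %/ g)%N in
  fixed_sum (rotation n.+1 ^+ g)%g =
  necklace_coef d * 2 ^+ g + 2 * (~~ (3 %| d)%N)%:R * (-1) ^+ g.
Proof.
move=> dvd_g d.
pose F k o : rat :=
  if (o %| d)%N then 2 ^+ g + (-1) ^+ g * (k%:R - 1) else 0.
transitivity (\sum_(s : {perm color}) F (num_fixed s) #[s]%g).
  apply: eq_bigr => s _; rewrite /F order_dvdn; case: eqP => [sd1 | sd1].
    by rewrite card_fixed_rotation.
  rewrite (@fixed_eq0 n d) ?cards0 //; last exact/eqP.
  by rewrite -expgM mulnC divnK // -[X in (_ ^+ X)%g](order_rotation n) expg_order.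
rewrite sum_perm3 /F /necklace_coef dvd1n.
have -> : gcdn d 6 = ((1 + (2 %| d)) * (1 + 2 * (3 %| d)))%N.
  have -> : (2 %| d)%N = (2 %| d %% 6)%N by lia.
  have -> : (3 %| d)%N = (3 %| d %% 6)%N by lia.
  rewrite -gcdn_modl; have := ltn_pmod d (isT : 0 < 6)%N.
  by case: (d %% 6)%N => [|[|[|[|[|[|]]]]]].
by case: (2 %| d)%N; case: (3 %| d)%N => /=; ring.
Qed.

(** The rotations of order [d] are the [totient d] generators of the unique subgroup of order [d],
    and [X] is constant on them. *)
Lemma sum_rotations_by_order (n : nat) (X : {perm 'I_n.+1} -> rat) :
  (forall a b, <[a]>%g = <[b]>%g -> X a = X b) ->
  \sum_(t in <[rotation n.+1]>%g) X t =
  \sum_(d <- divisors n.+1)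
    (totient d)%:R * X (rotation n.+1 ^+ (n.+1 %/ d))%g.
Proof.
move=> Xcycle; set r := rotation _.
have o_r : #[r]%g = n.+1 := order_rotation n.
transitivity (\sum_(t in <[r]>%g) \sum_(d <- divisors n.+1 | #[t]%g == d) X t).
  apply: eq_bigr => t rt; rewrite -big_filter (eq_filter (a2 := pred1 #[t]%g)).
    rewrite filter_pred1_uniq ?big_seq1 ?divisors_uniq // -dvdn_divisors //.
    by have := order_dvdG rt; rewrite -[#|_|]/#[r]%g o_r.
  by move=> d; rewrite /= eq_sym.
rewrite (exchange_big_dep predT) //=; apply: eq_big_seq => d.
rewrite -dvdn_divisors // => dvd_d.
have d_gt0 : (0 < d)%N by apply: dvdn_gt0 dvd_d.
have o_rd : #[r ^+ (n.+1 %/ d)]%g = d.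
  rewrite orderXdiv o_r ?dvdn_div // divnA ?mulKn //.
have gen_rd t : ((t \in <[r]>) && (#[t] == d) =
    generator <[r ^+ (n.+1 %/ d)]> t)%g.
  rewrite /generator -[in LHS]o_rd eq_sym.
  apply/andP/idP => [[rt ot] | /eqP rt].
    by rewrite (eq_subG_cyclic (cycle_cyclic r)) ?cycle_subG ?mem_cycle.
  split; last by rewrite /order rt.
  by rewrite -cycle_subG -rt cycle_subG mem_cycle.
have -> : totient d = #|[set t | generator <[r ^+ (n.+1 %/ d)]> t]%g|.
  by rewrite -totient_gen o_rd.
rewrite -sum1_card natr_sum mulr_suml.
apply: eq_big => [t|t]; first by rewrite inE -gen_rd.
by rewrite gen_rd mul1r => /eqP/Xcycle ->.
Qed.

Lemma sum_totient_divisors (m : nat) : (0 < m)%N ->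
  (\sum_(d <- divisors m) totient d = m)%N.
Proof.
move=> m_gt0; rewrite -[RHS]sum_totient_dvd.
rewrite -(big_mkord (fun d => d %| m)%N totient) -[RHS]big_filter.
apply: perm_big; apply: uniq_perm; rewrite ?divisors_uniq ?filter_uniq ?iota_uniq //.
move=> d; rewrite -dvdn_divisors // mem_filter mem_index_iota /= ltnS.
by case: (boolP (d %| m)%N) => // /dvdn_leq ->.
Qed.

(** The divisors of [m] prime to [p] are exactly the divisors of its [p']-part. *)
Lemma sum_totient_divisors_p' (p m : nat) : prime p -> (0 < m)%N ->
  (\sum_(d <- divisors m | ~~ (p %| d)) totient d = m`_p^')%N.
Proof.
move=> p_pr m_gt0; rewrite -[RHS]sum_totient_divisors ?part_gt0 // -big_filter.
apply: perm_big; apply: uniq_perm; rewrite ?filter_uniq ?divisors_uniq // => d.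
rewrite mem_filter -!dvdn_divisors ?part_gt0 //.
apply/andP/idP => [[p'd dvd_dm] | dvd_d].
  rewrite -(partnC p m_gt0) Gauss_dvdr // in dvd_dm.
  by rewrite p_part coprime_sym coprimeXl // prime_coprime.
split; last by apply: dvdn_trans dvd_d (dvdn_part _ _).
apply/negP => dvd_pd; have := dvdn_trans dvd_pd dvd_d.
by apply/negP; rewrite -p'natE ?part_pnat.
Qed.

(** The quotient on the right is the 3'-part of [n]. For odd [n] every sign is -1; for even [n] the
    sum is twice the 3'-part of [n./2] minus that of [n], which is 0. *)
Lemma sum_totient_sign (n : nat) : (0 < n)%N ->
  \sum_(d <- divisors n) (totient d)%:R * ((~~ (3 %| d)%N)%:R * (-1) ^+ (n %/ d))
  = - (n%:R / 3 ^+ logn 3 n * (odd n)%:R) :> rat.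
Proof.
move=> n_gt0.
have -> : n%:R / 3 ^+ logn 3 n = (n`_3^')%N%:R :> rat.
  rewrite -{1}(partnC 3%N n_gt0) natrM p_part natrX mulrAC divff ?mul1r //.
  by rewrite expf_neq0.
(* For even [n], [n %/ d] is even exactly when [d] divides [n./2]. *)
pose h := n./2.
transitivity (\sum_(d <- divisors n | ~~ (3 %| d)%N) (totient d)%:R *
    (2 * ((~~ odd n) && (d %| h))%N%:R - 1) : rat).
  rewrite [RHS]big_mkcond; apply: eq_big_seq => d; rewrite -dvdn_divisors //.
  case/dvdnP=> q Dn; case: ifP => _; last by rewrite mul0r mulr0.
  have d_gt0 : (0 < d)%N by move: n_gt0; rewrite Dn muln_gt0 => /andP[].
  rewrite mul1r {1}Dn mulnK // -signr_odd; congr (_ * _).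
  have -> : (~~ odd n && (d %| h))%N = ~~ odd q.
    apply/andP/idP => [[even_n /dvdnP[k Dh]] | even_q].
      have Dn2 : n = (k.*2 * d)%N by rewrite -doubleMl -Dh /h; lia.
      have /eqP := etrans (esym Dn) Dn2; rewrite eqn_pmul2r // => /eqP ->.
      by rewrite odd_double.
    have Dq : q = q./2.*2 by rewrite even_halfK.
    rewrite Dn oddM (negPf even_q); split=> //.
    by rewrite /h Dn Dq -doubleMl doubleK dvdn_mull.
  by case: (odd q) => /=; ring.
under eq_bigr => d _ do rewrite mulrBr mulr1 mulrCA.
rewrite big_split /= sumrN -mulr_sumr -natr_sum sum_totient_divisors_p' //.
case: (boolP (odd n)) => [odd_n | even_n] /=.
  by rewrite big1 => [|d _]; rewrite ?mulr0 ?add0r ?mulr1.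
have h_gt0 : (0 < h)%N by rewrite /h; lia.
have -> : \sum_(d <- divisors n | ~~ (3 %| d)%N) (totient d)%:R * (d %| h)%N%:R
   = (h`_3^')%N%:R :> rat.
  rewrite -sum_totient_divisors_p' // natr_sum -[RHS]big_filter.
  transitivity (\sum_(d <- divisors n | ~~ (3 %| d)%N && (d %| h)%N)
                  (totient d)%:R : rat).
    rewrite big_mkcondr; apply: eq_bigr => d _.
    by case: (d %| h)%N; rewrite ?mulr1 ?mulr0.
  rewrite -[LHS]big_filter; apply: perm_big.
  apply: uniq_perm; rewrite ?filter_uniq ?divisors_uniq // => d.
  rewrite !mem_filter -!dvdn_divisors // -andbA; congr (_ && _).
  apply: andb_idr => /dvdn_trans; apply; apply/dvdnP; exists 2%N.
  by rewrite /h; lia.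
have -> : (n`_3^' = 2 * h`_3^')%N.
  have -> : n = (2 * h)%N by rewrite /h; lia.
  by rewrite partnM // part_pnat_id.
by rewrite natrM mulr0 subrr.
Qed.

(** * The counting formulas *)

Lemma sum_fixed_sum_rotation (n : nat) :
  \sum_(t in <[rotation n.+1]>%g) fixed_sum t =
  6 * n.+1%:R * (num_necklaces n.+1)%:R.
Proof.
rewrite -(burnside_recolor (D := [group of <[rotation n.+1]>%g])).
  by rewrite /= -orderE order_rotation mulrC.
by rewrite setXS // cycle_subG mem_gen // !inE eqxx.
Qed.

Lemma necklace_formula (n : nat) : (0 < n)%N ->
  (num_necklaces n)%:R =
    necklace_sum n - 1 / 3 ^+ (1 + logn 3 n) * (odd n)%:R :> rat.
Proof.
case: n => // n _; have := sum_fixed_sum_rotation n.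
rewrite (sum_rotations_by_order (@fixed_sum_cycle n)).
under eq_big_seq => d.
  rewrite -dvdn_divisors // => dvd_d.
  rewrite fixed_sum_rotation ?dvdn_div // divnA // mulKn // mulrDr.
  rewrite -[2 * _ * _]mulrA [X in _ + X]mulrCA.
  over.
rewrite big_split /= -mulr_sumr sum_totient_sign // => E.
have N0 : n.+1%:R != 0 :> rat by rewrite pnatr_eq0.
have T0 : 3 ^+ logn 3 n.+1 != 0 :> rat by rewrite expf_neq0.
apply: (@mulfI _ (6 * n.+1%:R)); first by rewrite mulf_neq0.
rewrite -E /necklace_sum exprS natrM mulrBr; congr (_ + _).
  rewrite div1r mulVKf ?mulf_neq0 //.
  by apply: eq_bigr => d _; rewrite /necklace_coef; ring.
by move: (3 ^+ _) (n.+1%:R) T0 N0 => T N T0 N0; field.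
Qed.

(* For [n = 1, 2] the reflection is the identity. *)
Lemma small_bracelets (n : nat) : (n < 2)%N ->
  num_bracelets n.+1 = num_necklaces n.+1.
Proof.
move=> n_lt2; rewrite /num_bracelets /num_necklaces.
have refl1 : (reflection n.+1 = 1)%g.
  apply/permP => i; rewrite permE perm1; apply: val_inj => /=.
  by case: n n_lt2 i => [|[|//]] _ [[|[|//]]].
have gen1 : (<<[set rotation n.+1; reflection n.+1]>> = <[rotation n.+1]>)%g.
  apply/eqP; rewrite eqEsubset gen_subG cycle_subG mem_gen ?inE ?eqxx // andbT.
  by rewrite subUset !sub1set cycle_id refl1 group1.
by rewrite /= gen1.
Qed.

Lemma bracelet_formula (n : nat) : (0 < n)%N ->
  (num_bracelets n)%:R = ((num_necklaces n)%:R + reflection_term n) / 2 :> rat.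
Proof.
case: n => // n _; have [n_gt1 | n_le1] := ltnP 1 n.
  pose D := [group of <<[set rotation n.+1; reflection n.+1]>>%g].
  have oD : #|D| = (n.+1 + n.+1)%N.
    rewrite -sum1_card (sum_dihedral (R := nat) _ n_gt1) /=.
    by rewrite sum1_card -orderE order_rotation.
  have := burnside_recolor (D := D) (subxx _).
  rewrite -[#|_|]/(num_bracelets n.+1) oD sum_dihedral // sum_fixed_sum_rotation.
  rewrite sum_fixed_sum_reflection ?(ltnW n_gt1) // natrD => E.
  have N0 : n.+1%:R != 0 :> rat by rewrite pnatr_eq0.
  apply: (@mulfI _ (12 * n.+1%:R)); first by rewrite mulf_neq0.
  transitivity (6 * n.+1%:R * (num_necklaces n.+1)%:R +
                6 * n.+1%:R * reflection_term n.+1 : rat); last by field.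
  by rewrite -E; ring.
(* With one or two beads, bracelets and necklaces agree in number, so it remains to see that this
   number is the reflection term: 0 and 1 respectively. *)
rewrite small_bracelets // necklace_formula // /necklace_sum /reflection_term.
case: n n_le1 => [|[|//]] _.
  by rewrite (_ : divisors 1 = [:: 1%N]) // big_seq1 lognE.
by rewrite (_ : divisors 2 = [:: 1; 2]%N) // big_cons big_seq1.
Qed.

(** The term subtracted from [necklace_sum n] lies in [[0, 1)] and the difference is an integer. *)
Lemma necklace_floor (n : nat) : (0 < n)%N ->
  (num_necklaces n)%:R = (Num.floor (necklace_sum n))%:~R :> rat.
Proof.
move=> n_gt0; have := necklace_formula n_gt0; set c := 1 / _ * _ => E.
have [c_ge0 c_lt1] : 0 <= c /\ c < 1.
  rewrite /c mul1r; split; first by rewrite mulr_ge0 ?invr_ge0 ?exprn_ge0.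
  case: (odd n); rewrite ?mulr0 // mulr1 invf_lt1 ?exprn_gt0 //.
  by rewrite exprn_egt1.
rewrite (@floor_def _ _ (num_necklaces n)%:Z) //.
by rewrite intrD -pmulrn E; apply/andP; split; lra.
Qed.

Theorem theorem5p2 (n : nat) (n_ge1 : (1 <= n)%N) :
  [/\ (num_bracelets n)%:R = ((num_necklaces n)%:R + reflection_term n) / 2,
      (num_necklaces n)%:R =
        necklace_sum n - 1 / 3 ^+ (1 + logn 3 n) * (odd n)%:R
    & necklace_sum n - 1 / 3 ^+ (1 + logn 3 n) * (odd n)%:R =
        (Num.floor (necklace_sum n))%:~R].
Proof.
split; first exact: bracelet_formula; first exact: necklace_formula.
by rewrite -necklace_formula // necklace_floor.
Qed.
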